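(* Let $G$ be a (simple, undirected) graph with vertex set $[n]$. Then the CI model induced by the graph associahedron $\Delta_G=\Delta_{\mathcal{K}(G)}$ coincides with the undirected graphical model of $G$, i.e. $\mathcal{M}_{\mathcal{K}(G)}=\mathcal{M}^G$.
   Context: $[n]=\{1,\dots,n\}$. A CI statement is $i\perp\!\!\!\perp j\mid C$ with $i\ne j$ in $[n]$ and $C\subseteq[n]\setminus\{i,j\}$ (symmetric in $i,j$). $\mathcal{K}(G)$ is the collection of all subsets $K\subseteq[n]$ such that the induced subgraph $G|_K$ is connected. For $K\subseteq[n]$ let $\Delta_K=\mathrm{conv}\{e_k:k\in K\}\subset\mathbb{R}^n$. The graph associahedron is the Minkowski sum $\Delta_G=\Delta_{\mathcal{K}(G)}=\sum_{K\in\mathcal{K}(G)}\Delta_K$ (over nonempty $K$). Equivalently, let $w_K(I)=1$ if $K\cap I\ne\emptyset$ and $w_K(I)=0$ otherwise, and $w_{\mathcal{K}(G)}=\sum_{K\in\mathcal{K}(G)}w_K$; then $\Delta_G=Q_{w_{\mathcal{K}(G)}}$, where $Q_w=\{x\in\mathbb{R}^n:\sum_{i=1}^n x_i=w([n]),\ \sum_{i\in I}x_i\le w(I)\ \forall\,\emptyset\ne I\subseteq[n]\}$. The normal fan of $\Delta_G$ (with respect to maximizing linear functionals $u\cdot x$) is a coarsening of the $S_n$-fan, whose maximal cones are $\{u\in\mathbb{R}^n:u_{\delta_1}\ge u_{\delta_2}\ge\cdots\ge u_{\delta_n}\}$ for permutations $\delta=(\delta_1,\dots,\delta_n)$ of $[n]$.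 Two maximal cones $\delta,\delta'$ of the $S_n$-fan share a wall if $\delta'$ arises from $\delta$ by exchanging $\delta_k$ and $\delta_{k+1}$ for some $k$; this wall is labelled by the CI statement $\delta_k\perp\!\!\!\perp\delta_{k+1}\mid\{\delta_1,\dots,\delta_{k-1}\}$. The CI model $\mathcal{M}_{\mathcal{K}(G)}$ induced by $\Delta_G$ is the set of labels of all walls $\{\delta,\delta'\}$ such that the maximal cones indexed by $\delta$ and $\delta'$ lie in the same maximal cone of the normal fan of $\Delta_G$. The undirected graphical model (Markov random field) of $G$ is the set $\mathcal{M}^G$ of all CI statements $i\perp\!\!\!\perp j\mid C$ such that the restriction of $G$ to $[n]\setminus C$ contains no path from $i$ to $j$. *)

(* Defs.v *)
From mathcomp Require Import all_boot all_order all_algebra all_fingroup.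
From mathcomp Require Import boolp classical_sets reals.

Set Implicit Arguments.
Unset Strict Implicit.
Unset Printing Implicit Defensive.

Import Order.TTheory GRing.Theory Num.Theory.

Local Open Scope classical_set_scope.
Local Open Scope ring_scope.

(* The vertex set [n] is 'I_n, numbered from 0; a graph on [n] is given by its
   adjacency relation. *)
Definition induced n (e : rel 'I_n) (K : {set 'I_n}) : rel 'I_n :=
  [rel x y in K | e x y].

(* The empty set is left out, since only nonempty K contribute a simplex. *)
Definition connected_sets n (e : rel 'I_n) : {set {set 'I_n}} :=
  [set K : {set 'I_n} | (K != finset.set0) &&
    [forall x in K, forall y in K, connect (induced e K) x y]]%SET.

Definition conv (R : realType) n (I : finType) (K : {set I})
    (p : I -> 'rV[R]_n) : set 'rV[R]_n :=
  [set x | exists a : I -> R,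
    [/\ forall i, i \in K -> 0 <= a i,
        \sum_(i in K) a i = 1
      & x = \sum_(i in K) a i *: p i]].

Definition minkowski_sum (R : realType) n (I : finType) (J : {set I})
    (P : I -> set 'rV[R]_n) : set 'rV[R]_n :=
  [set x | exists y : I -> 'rV[R]_n,
    (forall j, j \in J -> P j (y j)) /\ x = \sum_(j in J) y j].

Definition simplex (R : realType) n (K : {set 'I_n}) : set 'rV[R]_n :=
  conv K (fun k => delta_mx 0 k).

Definition graph_associahedron (R : realType) n (e : rel 'I_n) :
    set 'rV[R]_n :=
  minkowski_sum (connected_sets e) (@simplex R n).
Arguments graph_associahedron R {n} e _.

Definition dot (R : realType) n (u x : 'rV[R]_n) : R :=
  \sum_(i < n) u 0 i * x 0 i.

Definition face (R : realType) n (P : set 'rV[R]_n) (u : 'rV[R]_n) :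
    set 'rV[R]_n :=
  [set x | P x /\ forall y, P y -> dot u y <= dot u x].

Definition normal_cone (R : realType) n (P F : set 'rV[R]_n) :
    set 'rV[R]_n :=
  [set u | F `<=` face P u].

Definition normal_fan (R : realType) n (P : set 'rV[R]_n) :
    set (set 'rV[R]_n) :=
  [set s | exists u, face P u !=set0 /\ s = normal_cone P (face P u)].

Definition maximal_cone (R : realType) n (P : set 'rV[R]_n)
    (s : set 'rV[R]_n) : Prop :=
  normal_fan P s /\ forall t, normal_fan P t -> s `<=` t -> t = s.

(* A permutation d of [n] is read as the sequence d 0, d 1, ..., d (n-1). *)
Definition Sn_cone (R : realType) n (d : 'S_n) : set 'rV[R]_n :=
  [set u | forall i j : 'I_n, (i <= j)%N -> u 0 (d j) <= u 0 (d i)].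

Definition same_maximal_cone (R : realType) n (P : set 'rV[R]_n)
    (d d' : 'S_n) : Prop :=
  exists s, [/\ maximal_cone P s, Sn_cone d `<=` s & Sn_cone d' `<=` s].

(* The pair ({i, j}, C) encodes the statement "i independent of j given C";
   using the unordered pair {i, j} makes it symmetric in i and j. *)
Definition ci n (i j : 'I_n) (C : {set 'I_n}) : {set 'I_n} * {set 'I_n} :=
  ([set i; j]%SET, C).

(* Permutations compose from left to right, so that tperm k k' * d is d with
   its entries at the positions k and k' = k + 1 exchanged. *)
Definition induced_CI_model (R : realType) n (P : set 'rV[R]_n) :
    set ({set 'I_n} * {set 'I_n}) :=
  [set c | exists (d d' : 'S_n) (k k' : 'I_n),
    [/\ k' = k.+1 :> nat,
        d' = (tperm k k' * d)%g,
        same_maximal_cone P d d'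
      & c = ci (d k) (d k') [set d i | i : 'I_n & (i < k)%N]%SET]].

Definition graphical_model n (e : rel 'I_n) :
    set ({set 'I_n} * {set 'I_n}) :=
  [set c | exists (i j : 'I_n) (C : {set 'I_n}),
    [/\ i != j, i \notin C /\ j \notin C,
        ~~ connect (induced e (finset.setC C)) i j
      & c = ci i j C]].

(* Main.v *)
(* A permutation d determines the point v_d = sum_K e_(first element of K in d)
   of the graph associahedron.  It maximizes every functional in the cone of d,
   and it is the only maximizer for a functional in the interior of that cone,
   so d and d' lie in the same maximal cone of the normal fan iff v_d = v_d'.
   If d' exchanges two consecutive entries i, j of d preceded by C, the first
   element changes exactly for the connected K that contain i and j and avoid C;
   such a K exists iff i and j are connected outside C. *)
Require Import Defs.
From mathcomp Require Import all_boot all_order all_algebra all_fingroup.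
From mathcomp Require Import boolp classical_sets reals.
From mathcomp Require Import zify.

Set Implicit Arguments.
Unset Strict Implicit.
Unset Printing Implicit Defensive.

Import Order.TTheory GRing.Theory Num.Theory.

Local Open Scope ring_scope.

(** * Linear functionals on sums and simplices *)

Section Dot.
Variables (R : realType) (n : nat).
Implicit Types u : 'rV[R]_n.

Lemma dot_delta u (k : 'I_n) : dot u (delta_mx 0 k) = u 0 k.
Proof.
rewrite /dot (bigD1 k) //= mxE !eqxx mulr1 big1 ?addr0 // => j jk.
by rewrite mxE (negPf jk) andbF mulr0.
Qed.

Lemma dot_sumZ (I : finType) (A : {set I}) u (a : I -> R) (y : I -> 'rV[R]_n) :
  dot u (\sum_(i in A) a i *: y i) = \sum_(i in A) a i * dot u (y i).
Proof.
rewrite /dot; under [RHS]eq_bigr do rewrite mulr_sumr.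
rewrite exchange_big /=; apply: eq_bigr => j _.
rewrite summxE mulr_sumr; apply: eq_bigr => i _.
by rewrite mxE mulrCA.
Qed.

Lemma dot_sum (I : finType) (A : {set I}) u (y : I -> 'rV[R]_n) :
  dot u (\sum_(i in A) y i) = \sum_(i in A) dot u (y i).
Proof.
transitivity (dot u (\sum_(i in A) 1 *: y i)).
  by congr (dot u _); apply: eq_bigr => i _; rewrite scale1r.
by rewrite dot_sumZ; apply: eq_bigr => i _; rewrite mul1r.
Qed.

Lemma delta_simplex (K : {set 'I_n}) x :
  x \in K -> simplex K (delta_mx 0 x : 'rV[R]_n).
Proof.
move=> xK; exists (fun i => (i == x)%:R); split.
- by move=> i _; case: (i == x).
- rewrite (bigD1 x) //= eqxx big1 ?addr0 // => i /andP[_ /negPf->] //.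
- rewrite (bigD1 x) //= eqxx scale1r big1 ?addr0 // => i /andP[_ /negPf->].
  by rewrite scale0r.
Qed.

Lemma dot_simplex_le u (K : {set 'I_n}) x y :
  (forall i, i \in K -> u 0 i <= u 0 x) -> simplex K y -> dot u y <= u 0 x.
Proof.
move=> ux [a [a0 a1 ->]]; rewrite dot_sumZ -[leRHS]mul1r -a1 mulr_suml.
by apply: ler_sum => i iK; rewrite dot_delta ler_wpM2l ?a0 ?ux.
Qed.

(** If [y] has weights [a], then [u 0 x - dot u y] is the sum of the nonnegative terms
    [a i * (u 0 x - u 0 i)]. When it vanishes, strictness kills every weight except [a x]. *)
Lemma dot_simplex_eq u (K : {set 'I_n}) x y : x \in K ->
    (forall i, i \in K -> i != x -> u 0 i < u 0 x) ->
  simplex K y -> dot u y = u 0 x -> y = delta_mx 0 x.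
Proof.
move=> xK ux [a [a0 a1 ->]]; rewrite dot_sumZ => uy.
have gap0 : \sum_(i in K) a i * (u 0 x - u 0 i) = 0.
  under eq_bigr do rewrite mulrBr.
  rewrite sumrB -mulr_suml a1 mul1r -[X in X - _]uy; apply/eqP.
  by rewrite subr_eq0; apply/eqP/eq_bigr => i _; rewrite dot_delta.
have gap_ge0 i : i \in K -> 0 <= a i * (u 0 x - u 0 i).
  move=> iK; rewrite mulr_ge0 ?a0 // subr_ge0.
  by have [->//|ix] := eqVneq i x; exact/ltW/ux.
have a_eq0 i : i \in K -> i != x -> a i = 0.
  move=> iK ix; have /eqP := psumr_eq0P gap_ge0 gap0 iK.
  by rewrite mulf_eq0 subr_eq0 (gt_eqF (ux _ iK ix)) orbF => /eqP.
rewrite (bigD1 x) //= big1 ?addr0 => [|i /andP[iK ix]]; last first.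
  by rewrite a_eq0 ?scale0r.
suff -> : a x = 1 by rewrite scale1r.
rewrite -a1 (bigD1 x) //= big1 ?addr0 // => i /andP[iK ix]; exact: a_eq0.
Qed.

End Dot.

(** * The vertex of a permutation and the normal fan *)

Section Vertex.
Variables (n : nat).
Implicit Types (d : 'S_n) (K : {set 'I_n}).

(** [d^-1%g x] is the position of [x] in the sequence [d]. *)
Definition is_first d K (x : 'I_n) : bool :=
  (x \in K) && [forall y in K, (d^-1%g x <= d^-1%g y)%N].

Lemma is_firstP d K x :
  reflect (x \in K /\ forall y, y \in K -> (d^-1%g x <= d^-1%g y)%N)
          (is_first d K x).
Proof. by apply: (iffP andP) => -[xK /forall_inP]. Qed.

Lemma is_first_exists d K : K != finset.set0 -> exists x, is_first d K x.
Proof.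
case/set0Pn=> x0 x0K.
case: (arg_minnP (fun x => nat_of_ord (d^-1%g x)) x0K) => x xK xmin.
by exists x; apply/is_firstP.
Qed.

Lemma is_first_inj d K x y : is_first d K x -> is_first d K y -> x = y.
Proof.
move=> /is_firstP[xK xmin] /is_firstP[yK ymin]; apply: (@perm_inj _ d^-1%g).
by apply/val_inj/anti_leq; rewrite xmin ?ymin.
Qed.

Variables (R : realType) (e : rel 'I_n).
Implicit Types u : 'rV[R]_n.

Let P : set 'rV[R]_n := graph_associahedron R e.

(** Writing the unit vector as an indicator row avoids choosing the first element, and makes each
    coordinate of [vertex] a count of connected sets. *)
Definition first_mx d K : 'rV[R]_n := \row_j (is_first d K j)%:R.

Definition vertex d : 'rV[R]_n := \sum_(K in connected_sets e) first_mx d K.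

Lemma first_mxE d K x : is_first d K x -> first_mx d K = delta_mx 0 x.
Proof.
move=> dKx; apply/rowP => j; rewrite !mxE eqxx /=; congr (_ : bool)%:R.
by apply/idP/eqP => [/is_first_inj/(_ dKx)|->].
Qed.

Lemma connected_sets_first d K :
  K \in connected_sets e -> exists x, is_first d K x.
Proof. by rewrite inE => /andP[/is_first_exists]. Qed.

Lemma vertexE d j :
  vertex d 0 j = #|[set K in connected_sets e | is_first d K j]|%:R.
Proof.
rewrite summxE -sum1_card natr_sum big_mkcond [RHS]big_mkcond /=.
apply: eq_bigr => K _; rewrite [in RHS]inE mxE.
by case: (K \in _) => //=; case: is_first.
Qed.

Lemma vertex_in d : P (vertex d).
Proof.
exists (first_mx d); split => // K /(connected_sets_first d)[x dKx].
by rewrite (first_mxE dKx); apply: delta_simplex; case/is_firstP: dKx.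
Qed.

Lemma Sn_cone_first d K x y u : Sn_cone d u -> is_first d K x -> y \in K ->
  u 0 y <= u 0 x.
Proof.
move=> du /is_firstP[_ xmin] yK.
by have := du _ _ (xmin y yK); rewrite !permKV.
Qed.

Lemma dot_simplex_first d u K y : Sn_cone d u -> K \in connected_sets e ->
  simplex K y -> dot u y <= dot u (first_mx d K).
Proof.
move=> du /(connected_sets_first d)[x dKx] Ky.
rewrite (first_mxE dKx) dot_delta.
by apply: dot_simplex_le Ky => i; exact: Sn_cone_first dKx.
Qed.

(** A functional is maximized over a Minkowski sum summand by summand. *)
Lemma vertex_face d u : Sn_cone d u -> face P u (vertex d).
Proof.
move=> du; split; first exact: vertex_in.
move=> _ [y [Py ->]]; rewrite !dot_sum; apply: ler_sum => K Ke.
exact/dot_simplex_first/Py.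
Qed.

(** Its values along [d] are 0, -1, -2, ...; being strictly decreasing, it lies in the interior of
    the cone of [d]. *)
Definition interior_functional d : 'rV[R]_n := \row_j - (d^-1%g j : nat)%:R.

Lemma interior_functional_cone d : Sn_cone d (interior_functional d).
Proof. by move=> i j ij; rewrite !mxE !permK lerN2 ler_nat. Qed.

(** The gaps to the maximum on the individual simplices are nonnegative and add up to 0, so each
    summand of [z] is a maximizer on its simplex, and this maximizer is unique. *)
Lemma face_interior d z : face P (interior_functional d) z -> z = vertex d.
Proof.
set u := interior_functional d; have du := interior_functional_cone d.
case=> -[y [Py ->]] /(_ _ (vertex_in d)); rewrite !dot_sum => le_vz.
have gap_ge0 K : K \in connected_sets e ->
    0 <= dot u (first_mx d K) - dot u (y K).
  by move=> Ke; rewrite subr_ge0; exact/dot_simplex_first/Py.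
have gap0 : \sum_(K in connected_sets e)
    (dot u (first_mx d K) - dot u (y K)) = 0.
  by apply/le_anti; rewrite sumr_ge0 // andbT sumrB subr_le0.
apply: eq_bigr => K Ke; have [x dKx] := connected_sets_first d Ke.
have /eqP := psumr_eq0P gap_ge0 gap0 Ke.
rewrite (first_mxE dKx) dot_delta subr_eq0 => /eqP/esym uy.
have [xK xmin] := is_firstP _ _ _ dKx.
apply: (dot_simplex_eq xK _ (Py K Ke) uy) => i iK ix.
rewrite !mxE ltrN2 ltr_nat ltn_neqAle xmin // andbT.
by rewrite (inj_eq val_inj) (inj_eq perm_inj) eq_sym.
Qed.

Lemma same_maximal_coneP d d' :
  same_maximal_cone P d d' <-> vertex d = vertex d'.
Proof.
split=> [[s [[[u [[z uz] ->]] _] ds d's]]|dd'].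
  (* The common cone contains both interior functionals, so the maximizer [z] of [u] also maximizes
     each of them and equals both vertices. *)
  have /ds/(_ _ uz)/face_interior <- := interior_functional_cone d.
  by have /d's/(_ _ uz)/face_interior := interior_functional_cone d'.
have faced := vertex_face (interior_functional_cone d).
exists (normal_cone P (face P (interior_functional d))); split.
- split; first by exists (interior_functional d); split=> //; exists (vertex d).
  (* Maximality: a larger normal cone still contains the interior functional, so its face is a
     nonempty subset of the single point [vertex d]. *)
  move=> _ [u [[z uz] ->]] sub.
  have face_sub : (face P u `<=` face P (interior_functional d))%classic.
    by apply: sub => ?.
  suff -> : face P u = face P (interior_functional d) by [].
  apply/seteqP; split=> // w /face_interior ->.
  by rewrite -(face_interior (face_sub _ uz)).
- by move=> u du w /face_interior ->; exact: vertex_face.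
- by move=> u du w /face_interior ->; rewrite dd'; exact: vertex_face.
Qed.

End Vertex.

(** * Connected sets and paths *)

Section Connectivity.
Variables (n : nat) (e : rel 'I_n).
Hypothesis e_sym : symmetric e.

Lemma induced_sym (K : {set 'I_n}) : symmetric (induced e K).
Proof.
by move=> x y; rewrite /induced /= e_sym; case: (x \in K); case: (y \in K).
Qed.

Lemma induced_sub (K L : {set 'I_n}) :
  K \subset L -> subrel (induced e K) (induced e L).
Proof.
move=> /fintype.subsetP KL x y; rewrite /induced /=.
by move=> /andP[/andP[/KL -> /KL ->] ->].
Qed.

(** The witness is the connected component of [i] in [L]. Assuming [i \in L] matters when [i = j],
    because [connect] is reflexive even outside [L]. *)
Lemma connected_sets_connect (L : {set 'I_n}) i j : i \in L ->
  reflect (exists K : {set 'I_n},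
             [/\ K \in connected_sets e, i \in K, j \in K & K \subset L])
          (connect (induced e L) i j).
Proof.
move=> iL; apply: (iffP idP) => [ij|[K [Ke iK jK KL]]]; last first.
  move: Ke; rewrite inE => /andP[_ /forall_inP/(_ _ iK)/forall_inP/(_ _ jK)].
  apply: connect_sub => x y xy; apply: connect1; exact: induced_sub xy.
pose K := [set x | connect (induced e L) i x]%SET.
have iK : i \in K by rewrite inE connect0.
(* A path from [i] in [L] stays in the component; induction at the end of the path keeps its
   starting point [i] fixed. *)
have KL_reach x : connect (induced e L) i x ->
    (x \in L) && connect (induced e K) i x.
  case/connectP=> p; elim/last_ind: p x => [|p y IH] x /=.
    by move=> _ ->; rewrite iL connect0.
  rewrite last_rcons rcons_path => /andP[pp py] ->.
  have /andP[zL iz] := IH _ pp erefl.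
  have Lz : connect (induced e L) i (last i p) by apply/connectP; exists p.
  have yL : y \in L by case/andP: py => /andP[].
  rewrite yL (connect_trans iz) // connect1 // /induced /=.
  rewrite !inE Lz (connect_trans Lz (connect1 py)) /=.
  by case/andP: py.
exists K; split=> //; last 2 first.
- by rewrite inE.
- by apply/fintype.subsetP => x; rewrite inE => /KL_reach/andP[].
rewrite inE; apply/andP; split; first by apply/set0Pn; exists i.
apply/forall_inP => x; rewrite inE => /KL_reach/andP[_ ix].
apply/forall_inP => y; rewrite inE => /KL_reach/andP[_]; apply: connect_trans.
by rewrite (sym_connect_sym (@induced_sym K)).
Qed.

End Connectivity.

(** * Exchanging two consecutive entries *)

Section Exchange.
Variables (n : nat).
Implicit Types (d : 'S_n) (k : 'I_n).

Definition prefix_set d k : {set 'I_n} := [set d i | i : 'I_n & (i < k)%N]%SET.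

Lemma mem_prefix_set d k x : (x \in prefix_set d k) = (d^-1%g x < k)%N.
Proof.
apply/imsetP/idP => [[i ik ->]|xk]; first by rewrite permK; rewrite inE in ik.
by exists (d^-1%g x); rewrite ?inE // permKV.
Qed.

Lemma exchangeV d k k' x :
  ((tperm k k' * d)^-1)%g x = tperm k k' ((d^-1)%g x).
Proof. by rewrite invMg tpermV permM. Qed.

Lemma tperm_consecutive_le k k' (a b : 'I_n) : k' = k.+1 :> nat ->
  (a <= b)%N -> ~ (a = k /\ b = k') -> (tperm k k' a <= tperm k k' b)%N.
Proof.
move=> kk' ab nab; have nab' : ~ (a = k :> nat /\ b = k' :> nat).
  by move=> [ak bk']; apply: nab; split; exact: val_inj.
have neqv (x y : 'I_n) : x <> y -> x <> y :> nat by move=> xy /val_inj.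
case: tpermP => [ak|ak|/neqv ak1 /neqv ak2];
  case: tpermP => [bk|bk|/neqv bk1 /neqv bk2];
  try have := congr1 val ak; try have := congr1 val bk; rewrite /=; lia.
Qed.

(** Only the relative order of [d k] and [d k'] changes. This can dethrone [x] only if [x = d k] and
    [d k'] is in [K]; as [x] comes first, [K] then avoids the prefix. *)
Lemma is_first_exchange d k k' (K : {set 'I_n}) x : k' = k.+1 :> nat ->
    ~ [/\ d k \in K, d k' \in K & K \subset (~: prefix_set d k)%SET] ->
  is_first d K x -> is_first (tperm k k' * d)%g K x.
Proof.
move=> kk' nK /is_firstP[xK xmin]; apply/is_firstP; split=> // y yK.
rewrite !exchangeV; apply: tperm_consecutive_le (xmin _ yK) _ => // -[xk yk'].
apply: nK; rewrite -xk -yk' !permKV; split=> //.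
by apply/fintype.subsetP => z /xmin zK; rewrite inE mem_prefix_set -leqNgt.
Qed.

Lemma vertex_exchange (R : realType) (e : rel 'I_n) d k k' : k' = k.+1 :> nat ->
  vertex R e d = vertex R e (tperm k k' * d)%g <->
  ~ exists K : {set 'I_n}, [/\ K \in connected_sets e, d k \in K, d k' \in K
                             & K \subset (~: prefix_set d k)%SET].
Proof.
move=> kk'; set d' := (tperm k k' * d)%g.
have d'k : d' k = d k' by rewrite permM tpermL.
have d'k' : d' k' = d k by rewrite permM tpermR.
have prefix' : prefix_set d' k = prefix_set d k.
  apply/setP => x; rewrite !mem_prefix_set exchangeV.
  by case: tpermP => [->|->|] //; rewrite kk' ?ltnn ltnNge leqnSn.
split=> [vv' [K [Ke ik jk' KC]]|noK].
  (* Coordinate [d k] strictly drops: moving [d k] later gives it no new set in which it is first,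
     and it loses [K]. *)
  have := congr1 (fun v : 'rV[R]_n => v 0 (d k)) vv'; rewrite !vertexE => /eqP.
  rewrite eqr_nat gtn_eqF //; apply: proper_card; apply/properP; split.
    apply/fintype.subsetP => L; rewrite !inE => /andP[-> /is_firstP[iL imin]] /=.
    apply/is_firstP; split=> // y yL; have := imin _ yL.
    rewrite !exchangeV permK tpermL kk'.
    by case: tpermP => [->|->|_ _] //; [rewrite ltnn|exact: ltnW].
  exists K; rewrite inE Ke /=.
    apply/is_firstP; split=> // y /(fintype.subsetP KC).
    by rewrite inE mem_prefix_set -leqNgt permK.
  apply/is_firstP => -[_ /(_ _ jk')].
  by rewrite !exchangeV !permK tpermL tpermR kk' ltnn.
apply: eq_bigr => K Ke; apply/rowP => x; rewrite !mxE; congr (_ : bool)%:R.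
apply/idP/idP.
  by apply: is_first_exchange => // -[iK jK KC]; apply: noK; exists K.
(* The exchange is an involution that preserves the prefix, so the converse is the same lemma
   applied to [d']. *)
have -> : d = (tperm k k' * d')%g by rewrite mulgA tperm2 mul1g.
apply: is_first_exchange => //; rewrite d'k d'k' prefix' => -[jK iK KC].
by apply: noK; exists K.
Qed.

(** List [C], then [i], [j], then the remaining vertices. With positions counted from 0, [i] stands
    at position [#|C|]. *)
Lemma exists_perm_prefix (i j : 'I_n) (C : {set 'I_n}) :
    i != j -> i \notin C -> j \notin C ->
  exists d k k', [/\ k' = k.+1 :> nat, d k = i, d k' = j & prefix_set d k = C].
Proof.
move=> ij iC jC.
pose s := enum C ++ i :: j :: enum (~: (i |: (j |: C)))%SET.
have s_uniq : uniq s.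
  rewrite cat_uniq /= !enum_uniq !inE !mem_enum !inE (negPf ij) !eqxx orbT /=.
  rewrite (negPf iC) (negPf jC) /= andbT; apply/hasPn => x.
  by rewrite !mem_enum !inE !negb_or => /and3P[].
have s_mem x : x \in s.
  rewrite mem_cat !inE !mem_enum !inE !negb_or.
  by case: (x == i); case: (x == j); case: (x \in C).
have s_size : size s = n.
  rewrite -[RHS]card_ord -(card_uniqP s_uniq); apply: eq_card => x.
  by rewrite s_mem.
(* The default [i] is never returned, since [s] has length [n]. *)
have f_inj : injective (fun x : 'I_n => nth i s x).
  move=> x y /eqP; rewrite nth_uniq ?s_size // => /eqP; exact: val_inj.
have sizeC : (#|C|.+1 < n)%N.
  suff : (#|C|.+1 < size s)%N by rewrite s_size.
  by rewrite size_cat /= -cardE addnS ltnS addnS ltnS leq_addr.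
exists (perm f_inj), (Ordinal (ltnW sizeC)), (Ordinal sizeC); split=> //.
- by rewrite permE nth_cat -cardE ltnn subnn.
- by rewrite permE nth_cat -cardE ltnNge leqnSn /= subSnn.
apply/setP => x; apply/imsetP/idP => [[y]|xC].
  rewrite inE permE nth_cat -cardE => /= yC ->.
  by rewrite yC -mem_enum mem_nth -?cardE.
have xs : (index x s < n)%N by move: (s_mem x); rewrite -index_mem s_size.
exists (Ordinal xs); last by rewrite permE nth_index.
by rewrite inE /= index_cat mem_enum xC cardE index_mem mem_enum.
Qed.

End Exchange.

(** * Equality of the two models *)

Theorem theorem17 (R : realType) (n : nat) (e : rel 'I_n)
    (e_sym : symmetric e) (e_irr : irreflexive e) :
  induced_CI_model (graph_associahedron R e) = graphical_model e.
Proof.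
have separation (d : 'S_n) (k k' : 'I_n) : k' = k.+1 :> nat ->
    same_maximal_cone (graph_associahedron R e) d (tperm k k' * d)%g <->
    ~~ connect (induced e (~: prefix_set d k)%SET) (d k) (d k').
  move=> kk'; rewrite same_maximal_coneP vertex_exchange //.
  have iC : d k \in (~: prefix_set d k)%SET.
    by rewrite inE mem_prefix_set permK ltnn.
  by split=> [noK|/negP noK]; [apply/negP|];
    move=> /(connected_sets_connect e_sym _ iC).
apply/seteqP; split=> [_ [d [_ [k [k' [kk' -> same ->]]]]]|].
  exists (d k), (d k'), (prefix_set d k); split=> //; last exact/separation.
    by rewrite (inj_eq perm_inj) -(inj_eq val_inj) /= kk' ltn_eqF.
  by rewrite !mem_prefix_set !permK kk' ltnn -leqNgt leqnSn.
(* By [separation], whether a wall counts depends only on its label, so any wall labelled by the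
   given statement will do. *)
move=> _ [i [j [C [ij [iC jC] sep ->]]]].
have [d [k [k' [kk' dk dk' dC]]]] := exists_perm_prefix ij iC jC.
exists d, (tperm k k' * d)%g, k, k'; split=> //.
  by apply/separation; rewrite // dk dk' dC.
by rewrite -/(prefix_set d k) dk dk' dC.
Qed.
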